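(* Let $q$ be a prime power, let $p$ be the characteristic of $\mathbb{F}_q$, let $n$ be a positive integer, and write $n=p^s n_0$ with $s\ge 0$ and $\gcd(n_0,p)=1$. Let $d$ be the least positive integer such that $q^d\equiv 1\pmod{n_0}$. For each positive integer $r$ let $v_r$ be the number of distinct monic irreducible factors of degree $r$ of $x^n-1$ over $\mathbb{F}_q$. Then the number $N_3$ of $3$-normal elements of $\mathbb{F}_{q^n}$ over $\mathbb{F}_q$ is $$N_3=\begin{cases}\left(v_1+\frac16 v_1(v_1-1)(v_1+4)+v_1v_2+v_3\right)q^{n-n_0-3}\displaystyle\prod_{r\mid d}(q^r-1)^{v_r} & \text{if } p^s>3,\\[2ex] \left(\frac{q}{q-1}v_1+\frac16 v_1(v_1-1)(v_1+4)+v_1v_2+v_3\right)q^{n-n_0-3}\displaystyle\prod_{r\mid d}(q^r-1)^{v_r} & \text{if } p^s=3,\\[2ex] \left(\left(\frac{q}{q-1}+\frac{v_1-2}{6}\right)v_1(v_1-1)+v_1v_2+v_3\right)q^{n-n_0-3}\displaystyle\prod_{r\mid d}(q^r-1)^{v_r} & \text{if } p^s=2,\\[2ex] \left(\frac{v_1(v_1-1)(v_1-2)}{6(q-1)^3}+\frac{v_1v_2}{(q-1)(q^2-1)}+\frac{v_3}{q^3-1}\right)\displaystyle\prod_{r\mid d}(q^r-1)^{v_r} & \text{if } n=n_0.\end{cases}$$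
   Context: For $\alpha\in\mathbb{F}_{q^n}$ put $g_\alpha(x)=\sum_{i=0}^{n-1}\alpha^{q^i}x^{n-1-i}\in\mathbb{F}_{q^n}[x]$. For $0\le k\le n$, the element $\alpha$ is called $k$-normal over $\mathbb{F}_q$ if $\gcd(x^n-1,g_\alpha(x))$, computed over $\mathbb{F}_{q^n}$, has degree $k$; here $\gcd(x^n-1,0)=x^n-1$, so $\alpha=0$ is the unique $n$-normal element (and there are no $k$-normal elements for $k>n$). Products over $r\mid d$ run over the positive divisors $r$ of $d$. The formulas are identities of rational numbers (exponents of $q$ may be negative). *)

(* Defs.v *)
From mathcomp Require Import all_boot all_order all_fingroup all_algebra all_field.

Set Implicit Arguments.
Unset Strict Implicit.
Unset Printing Implicit Defensive.

Import GRing.Theory.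
Local Open Scope ring_scope.

Definition g_poly (K : fieldType) (q n : nat) (a : K) : {poly K} :=
  \sum_(i < n) a ^+ (q ^ i) *: 'X^(n.-1 - i).

(* [size] is the degree plus one.  [gcdp] is only determined up to a nonzero
   constant factor, which does not affect its size, and [gcdp p 0 = p]. *)
Definition k_normal (K : fieldType) (q n k : nat) (a : K) : bool :=
  size (gcdp ('X^n - 1) (g_poly q n a)) == k.+1.

(* [finvect_type L] is [L] itself, with the finite type structure that it
   inherits from [F]. *)
Definition num_k_normal (F : finFieldType) (L : fieldExtType F)
    (k : nat) : nat :=
  #|[set a : finvect_type L | k_normal #|F| (\dim {:L}) k (a : L)]|.

(* The polynomials of degree [r] are found in the finite type [{poly_r.+1 F}]
   of polynomials of size at most [r.+1]. *)
Definition num_irr_factors (F : finFieldType) (n r : nat) : nat :=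
  #|[set f : {poly_r.+1 F} |
      [&& size f == r.+1, (f : {poly F}) \is monic, irreducibleb f
        & (f : {poly F}) %| 'X^n - 1]]|.

(* Main.v *)
(* Let P = p^s.  For a divisor D of X^n - 1 over F, exactly q^(n - deg D) elements a have
   D | g_a, because multiplication by f in F[X] modulo X^n - 1 carries g_a to g_b with
   b = f(Frobenius)(a).  The gcd of X^n - 1 and g_a descends to F[X], so it is a product of
   powers h^e with e <= P over the irreducible factors h of X^n - 1.  Counting with
   divisibility conditions, which are independent for distinct h, gives
     sum_a X^(deg gcd) = prod_h (sum_(j <= P) c_j(deg h) q^(deg h * (P - j))),
   with c_0 = 1 and c_j(r) = X^(r j) - X^(r (j - 1)).  The result is the coefficient of X^3. *)
From HB Require Import structures.
Require Import Defs.
From mathcomp Require Import all_boot all_order all_fingroup all_algebra all_field.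
From mathcomp Require Import cyclic cyclotomic ring.

Import GRing.Theory Num.Theory.
Local Open Scope ring_scope.

Set Implicit Arguments.
Unset Strict Implicit.
Unset Printing Implicit Defensive.

(** * Powers of the Frobenius map *)

Lemma expf_card_exp (F : finFieldType) (c : F) i : c ^+ (#|F| ^ i) = c.
Proof. by elim: i => [|i IH]; rewrite ?expr1 // expnSr exprM IH expf_card. Qed.

(** [#|F| ^ i] is a power of the characteristic of [L], so raising to it is additive. Packaging it
    as a morphism lets it pass through sums and polynomials later. *)
Lemma exists_frobenius (F : finFieldType) (L : fieldExtType F) (i : nat) :
  {f : {rmorphism L -> L} | forall x, f x = x ^+ (#|F| ^ i)}.
Proof.
have [p _ pcharFp] := finPcharP F.
pose f (x : L) := x ^+ (#|F| ^ i).
have pL : ([pchar L]).-nat (#|F| ^ i)%N.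
  rewrite pnatX; apply/orP; left.
  have : p.-nat #|[set: F]| := pprimeChar_pgroup pcharFp; rewrite cardsT.
  apply: sub_in_pnat => l _ /eqP ->.
  by rewrite (fmorph_pchar (in_alg L)).
have fB : zmod_morphism f.
  move=> x y; rewrite /f exprDn_pchar // ; congr (_ + _).
  by rewrite exprNn_pchar.
have fM : monoid_morphism f.
  by split=> [|x y]; rewrite /f ?expr1n ?exprMn.
pose fB' := GRing.isZmodMorphism.Build _ _ f fB.
pose fM' := GRing.isMonoidMorphism.Build _ _ f fM.
pose fLR : {rmorphism _ -> _} := HB.pack f fB' fM'.
by exists fLR.
Qed.

(** * The action of [F[X]] on [L] through Frobenius *)

Section FrobeniusModule.
Variables (F : finFieldType) (L : fieldExtType F).
Local Notation q := #|F|.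
Local Notation n := (\dim {:L}).
Local Notation g := (@g_poly L q n).
Local Notation toL := (map_poly (in_alg L)).

Lemma dim_gt0 : (0 < n)%N.
Proof. by rewrite adim_gt0. Qed.

Lemma expr_card_dim (a : L) : a ^+ (q ^ n) = a.
Proof.
by have := memvf a; rewrite (Fermat's_little_theorem {:L}%AS) => /eqP.
Qed.

Lemma coef_g (a : L) i : (i < n)%N -> (g a)`_(n.-1 - i) = a ^+ (q ^ i).
Proof.
move=> lin; rewrite /g_poly coef_sum (bigD1 (Ordinal lin)) //= big1 ?addr0.
  by rewrite coefZ coefXn eqxx mulr1.
move=> j; rewrite -val_eqE /= => ne; rewrite coefZ coefXn.
case: eqP => // e; last by rewrite mulr0.
case/negP: ne; have le k : (k < n)%N -> (k <= n.-1)%N by move=> kn; rewrite -ltnS prednK ?dim_gt0.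
by rewrite -[eqbLHS](subKn (le _ (ltn_ord j))) -e subKn ?le.
Qed.

Lemma size_g (a : L) : (size (g a) <= n)%N.
Proof.
apply: (leq_trans (size_sum _ _ _)); apply/bigmax_leqP => i _.
apply: (leq_trans (size_scale_leq _ _)); rewrite size_polyXn.
by rewrite (leq_ltn_trans (leq_subr _ _)) // ltn_predL dim_gt0.
Qed.

(** The degree of [g a] is below [n], and its coefficient of index [n.-1] is [a]. Together with
    [g_sub], this lets equalities in [L] be checked as congruences modulo ['X^n - 1]. *)
Lemma Xn_sub1_dvd_g (a : L) : ('X^n - 1 %| g a) = (a == 0).
Proof.
apply/idP/eqP => [d|->]; last first.
  rewrite /g_poly big1 ?dvdp0 // => i _.
  by rewrite expr0n expn_eq0 eqn0Ngt (ltnW (finNzRing_gt1 F)) //= scale0r.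
have/eqP: g a == 0.
  apply: contraLR d => nz; apply/negP => /(dvdp_leq nz).
  by rewrite size_XnsubC ?dim_gt0 // ltnNge size_g.
by move/(congr1 (fun h : {poly L} => h`_(n.-1 - 0))); rewrite coef_g ?dim_gt0 // coef0 expn0 expr1.
Qed.

Lemma g_sub a b : g (a - b) = g a - g b.
Proof.
rewrite /g_poly -sumrB; apply: eq_bigr => j _.
by have [f fE] := exists_frobenius L j; rewrite -!fE raddfB scalerBl.
Qed.

Lemma g_sum (I : Type) (r : seq I) (c : I -> F) (h : I -> L) :
  g (\sum_(i <- r) c i *: h i) = \sum_(i <- r) (c i)%:A *: g (h i).
Proof.
rewrite /g_poly; under [RHS]eq_bigr => i _ do rewrite scaler_sumr.
rewrite exchange_big /=; apply: eq_bigr => j _.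
have [f fE] := exists_frobenius L j.
rewrite -fE rmorph_sum scaler_suml; apply: eq_bigr => i _.
by rewrite scalerA mulr_algl /= fE exprZn expf_card_exp.
Qed.

(** Multiplication by ['X] shifts the coefficients. The top term [a *: 'X^n] has to wrap around to
    the constant term of [g (a ^+ q)], which is [a ^+ (q ^ n) = a]. *)
Lemma mulX_g a : 'X * g a = g (a ^+ q) + a *: ('X^n - 1).
Proof.
rewrite /g_poly; have := expr_card_dim a; have := dim_gt0.
case: (\dim {:L}) => // m _ an.
rewrite mulr_sumr big_ord_recl /= subn0 big_ord_recr /= subnn.
rewrite -exprM -expnS an expr0 expn0 expr1 scalerBr -scalerAr -exprS.
rewrite -addrA [_%:A + _]addrC subrK addrC; congr (_ + _).
apply: eq_bigr => i _.
rewrite -exprM -expnS -scalerAr -exprS; congr (_ *: 'X^_).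
by rewrite /bump /= add1n -subSn ?subSS.
Qed.

(* Writing s for the q-Frobenius of L, this is f(s) applied to a. *)
Definition frob_eval (f : {poly F}) (a : L) := \sum_(i < size f) f`_i *: a ^+ (q ^ i).

(** For a monomial, [mulX_g] is iterated; the general case follows by [F]-linearity of [g]. *)
Lemma mul_g_congr (f : {poly F}) a : 'X^n - 1 %| toL f * g a - g (frob_eval f a).
Proof.
have dX i : 'X^n - 1 %| 'X^i * g a - g (a ^+ (q ^ i)).
  elim: i => [|i IH]; first by rewrite expr0 mul1r expn0 expr1 subrr dvdp0.
  rewrite expnSr exprM; move: IH; set b := a ^+ _ => IH.
  have -> : 'X^(i.+1) * g a - g (b ^+ q) = 'X * ('X^i * g a - g b) + ('X * g b - g (b ^+ q)).
    by rewrite mulrBr addrA subrK exprS mulrA.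
  by rewrite dvdp_add ?dvdp_mull // mulX_g addrAC subrr add0r -mul_polyC dvdp_mull.
rewrite g_sum -{1}(coefK f) poly_def raddf_sum mulr_suml -sumrB /=.
apply: (big_ind (fun h => 'X^n - 1 %| h)) => [|h k|i _]; rewrite ?dvdp0 //.
  exact: dvdp_add.
rewrite map_polyZ /= map_polyXn -scalerAl -scalerBr -mul_polyC.
by rewrite dvdp_mull.
Qed.

(** The two sides have congruent images under [g]: both are congruent to [toL (f * h) * g a], named
    [z] below. *)
Lemma frob_evalM f h a : frob_eval (f * h) a = frob_eval f (frob_eval h a).
Proof.
apply/eqP; rewrite -subr_eq0 -Xn_sub1_dvd_g.
rewrite g_sub.
rewrite -(dvdp_addl _ (_ : 'X^n - 1 %|
  g (frob_eval f (frob_eval h a)) - toL f * g (frob_eval h a))); last first.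
  by rewrite -dvdpNr opprB mul_g_congr.
rewrite addrA subrK.
pose z := toL (f * h) * g a.
rewrite (_ : g _ - _ = - (z - g (frob_eval (f * h) a)) + (z - toL f * g (frob_eval h a))).
  rewrite dvdp_add ?dvdpNr ?mul_g_congr //.
  by rewrite /z rmorphM /= -mulrA -mulrBr dvdp_mull ?mul_g_congr.
by rewrite opprB addrA subrK.
Qed.

Lemma frob_eval_linear f : linear (frob_eval f).
Proof.
move=> c a b; rewrite /frob_eval scaler_sumr -big_split /=; apply: eq_bigr => i _.
have [h hE] := exists_frobenius L i.
rewrite -hE rmorphD /= !hE exprZn expf_card_exp scalerDr !scalerA mulrC //.
Qed.

(** The kernel consists of roots of the linearized polynomial [P], whose degree is [q] to the degree
    of [f]. *)
Lemma card_frob_eval_ker f : f != 0 ->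
  (#|[set a : finvect_type L | frob_eval f (a : L) == 0%R]| <= q ^ (size f).-1)%N.
Proof.
move=> nz; set A := [set _ | _]; pose P : {poly L} := \sum_(i < size f) (f`_i)%:A *: 'X^(q ^ i).
have szf : (size f = (size f).-1.+1)%N by rewrite prednK // lt0n size_poly_eq0.
have q_gt1 := finNzRing_gt1 F.
have szP : size P = (q ^ (size f).-1).+1.
  rewrite /P szf big_ord_recr /= addrC size_polyDl.
    rewrite size_scale ?size_polyXn //.
    by rewrite scaler_eq0 oner_eq0 orbF -lead_coefE lead_coef_eq0.
  rewrite size_scale ?size_polyXn; last first.
    by rewrite scaler_eq0 oner_eq0 orbF -lead_coefE lead_coef_eq0.
  apply: (leq_ltn_trans (size_sum _ _ _)); rewrite ltnS; apply/bigmax_leqP => i _.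
  apply: (leq_trans (size_scale_leq _ _)); rewrite size_polyXn.
  by rewrite ltn_exp2l.
rewrite -ltnS -szP cardE; apply: max_poly_roots.
- by rewrite -size_poly_eq0 szP.
- apply/allP => a; rewrite mem_enum inE => /eqP a0.
  apply/rootP; rewrite -[RHS]a0 /frob_eval horner_sum; apply: eq_bigr => i _.
  by rewrite hornerZ hornerXn mulr_algl.
- exact: enum_uniq.
Qed.

(* With H = (X^n - 1) / D, the condition says that a lies in the kernel of H(s).  Both
   kernels, of H(s) and D(s), are bounded by root counting, and the image of D(s) is in
   the kernel of H(s), so rank-nullity forces equality in both bounds. *)
Lemma card_dvd_g (D : {poly F}) : D %| 'X^n - 1 ->
  #|[set a : finvect_type L | toL D %| g (a : L)]| = (q ^ (n - (size D).-1))%N.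
Proof.
move=> dD; pose H := ('X^n - 1) %/ D.
have HD : 'X^n - 1 = H * D by rewrite divpK.
have nzX : 'X^n - 1 != 0 :> {poly F} by rewrite -size_poly_eq0 size_XnsubC ?dim_gt0.
have [nzH nzD] : H != 0 /\ D != 0.
  apply/andP; rewrite -negb_or -mulf_eq0 -HD; exact: nzX.
have szHD : ((size H).-1 + (size D).-1 = n)%N.
  have := size_mul nzH nzD; rewrite -HD size_XnsubC ?dim_gt0 //.
  rewrite -(prednK (_ : 0 < size H)%N) ?size_poly_gt0 //.
  by rewrite -(prednK (_ : 0 < size D)%N) ?size_poly_gt0 // addnS addSn => -[].
have toLX : toL ('X^n - 1) = 'X^n - 1 by rewrite rmorphB rmorph1 /= map_polyXn.
(* Multiplying by [toL H] turns divisibility by [toL D] into divisibility by ['X^n - 1], and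
   [toL H * g a] is congruent to [g (frob_eval H a)]. *)
have eqA (a : L) : (toL D %| g a) = (frob_eval H a == 0).
  rewrite -Xn_sub1_dvd_g -(dvdp_addr _ (mul_g_congr H a)) subrK.
  rewrite -(dvdp_mul2l _ _ (_ : toL H != 0)) ?map_poly_eq0 //.
  by rewrite -rmorphM -HD /= toLX.
have qH0 a : frob_eval (H * D) a = 0.
  apply/eqP; rewrite -Xn_sub1_dvd_g -(dvdp_addr _ (mul_g_congr (H * D) a)) subrK.
  by rewrite -HD toLX dvdp_mulr.
pose lin f : {linear finvect_type L -> finvect_type L} := HB.pack (frob_eval f)
   (GRing.isLinear.Build _ _ _ _ (frob_eval f) (@frob_eval_linear f)).
have kerE f : #|[set a : finvect_type L | frob_eval f (a : L) == 0%R]| =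
    (q ^ \dim (lker (linfun (lin f))))%N.
  by rewrite -card_vspace; apply: eq_card => a; rewrite inE memv_ker lfunE.
have -> : [set a : finvect_type L | toL D %| g (a : L)] =
    [set a : finvect_type L | frob_eval H (a : L) == 0%R].
  by apply/setP => a; rewrite !inE eqA.
rewrite kerE; congr (_ ^ _)%N.
have := card_frob_eval_ker nzH; have := card_frob_eval_ker nzD.
rewrite !kerE !leq_exp2l ?finNzRing_gt1 // => leD leH.
have sub : (limg (linfun (lin D)) <= lker (linfun (lin H)))%VS.
  apply/subvP => _ /memv_imgP[a _ ->]; rewrite memv_ker !lfunE /=.
  by rewrite -frob_evalM qH0.
have := limg_ker_dim (linfun (lin D)) fullv.
rewrite capfv (erefl : \dim {: finvect_type L} = n) => dimE.
apply/eqP; rewrite eqn_leq -{1}szHD addnK leH leq_subLR -[leqLHS]dimE.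
by rewrite leq_add // dimvS.
Qed.

End FrobeniusModule.

(** * Products of pairwise coprime polynomials *)

Section CoprimeProducts.
Variables (K : fieldType).
Implicit Types p d : {poly K}.

Lemma coprimep_irr p d : irreducible_poly p -> irreducible_poly d ->
  p \is monic -> d \is monic -> p != d -> coprimep p d.
Proof.
move=> ip id mp md; apply: contraR; rewrite irreducible_poly_coprime // negbK => pd.
rewrite -eqp_monic //; apply: (id.2) => //.
by rewrite neq_ltn ip.1 orbT.
Qed.

Lemma coprimep_bigprod (I : Type) (r : seq I) (Q : pred I) (h : I -> {poly K}) p :
  (forall i, Q i -> coprimep p (h i)) -> coprimep p (\prod_(i <- r | Q i) h i).
Proof.
move=> H; apply: (big_ind (fun d => coprimep p d)) => [|x y|i Qi]; rewrite ?coprimep1 //.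
  by rewrite coprimepMr => -> ->.
exact: H.
Qed.

Lemma dvdp_bigprod (I : eqType) (r : seq I) (h : I -> {poly K}) p :
  uniq r -> {in r &, forall i j, i != j -> coprimep (h i) (h j)} ->
  (\prod_(i <- r) h i %| p) = all (fun i => h i %| p) r.
Proof.
elim: r => [|i r IH] /=; first by rewrite big_nil dvd1p.
case/andP=> ir ur H; rewrite big_cons Gauss_dvdp ?IH //.
  by move=> j k jr kr; apply: H; rewrite inE ?jr ?kr orbT.
rewrite big_seq; apply: coprimep_bigprod => j jr; apply: H; rewrite ?mem_head //.
  by rewrite inE jr orbT.
by apply: contraNneq ir => ->.
Qed.

Lemma size_bigprod_monic (I : Type) (r : seq I) (h : I -> {poly K}) :
  (forall i, h i \is monic) ->
  ((size (\prod_(i <- r) h i)%R).-1 = \sum_(i <- r) (size (h i)).-1)%N.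
Proof.
move=> mh; have sm p : p \is monic -> size p = (size p).-1.+1.
  by move/monic_neq0; rewrite -size_poly_gt0; case: size.
elim: r => [|i r IH]; first by rewrite !big_nil size_poly1.
have mr : \prod_(j <- r) h j \is monic by apply: monic_prod.
rewrite !big_cons size_monicM ?monic_neq0 // -IH [in LHS](sm _ mr) [in LHS](sm _ (mh i)).
by rewrite addnS.
Qed.

End CoprimeProducts.

(** * Divisors of a product of powers of distinct irreducibles *)

Section Family.
Variables (K : finFieldType).
Implicit Types p d : {poly K}.

(** Strong induction on the size: when the finite test [irreducibleb] fails, it yields a nonconstant
    divisor of smaller size. *)
Lemma exists_irreducible p : (1 < size p)%N ->
  exists2 d, irreducible_poly d & (d \is monic) && (d %| p).
Proof.
have [m] := ubnP (size p); elim: m p => // m IH p pm p1.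
have p0 : p != 0 by rewrite -size_poly_gt0 ltnW.
have [/irreducibleP ip|] := boolP (irreducibleb p).
  exists ((lead_coef p)^-1 *: p); last first.
    rewrite monicE lead_coefZ mulVf ?lead_coef_eq0 // eqxx /=.
    by rewrite dvdpZl ?invr_eq0 ?lead_coef_eq0.
  split; first by rewrite size_scale ?invr_eq0 ?lead_coef_eq0.
  move=> d d1; rewrite dvdpZr ?invr_eq0 ?lead_coef_eq0 // => /(ip.2 _ d1) /eqp_trans; apply.
  by rewrite eqp_sym eqp_scale ?invr_eq0 ?lead_coef_eq0.
rewrite /irreducibleb p1 /= => /forallPn[d]; rewrite negb_imply -ltnNge -Pdiv.Idomain.dvdpE.
case/andP=> dp d1; have [|e ie /andP[me ed]] := IH d _ d1.
  by rewrite (leq_trans _ (pm : (size p <= m)%N)) // (leq_ltn_trans (size_npoly d)) //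
    ltn_predL ltnW.
by exists e => //; rewrite me (dvdp_trans ed dp).
Qed.

Variables (I : finType) (f : I -> {poly K}) (P : nat).
Hypothesis f_irr : forall i, irreducible_poly (f i).
Hypothesis f_monic : forall i, f i \is monic.
Hypothesis f_inj : injective f.
Local Notation M := (\prod_i f i ^+ P).

Lemma coprimep_family i j k l : i != j -> coprimep (f i ^+ k) (f j ^+ l).
Proof.
move=> ij; apply: coprimep_expl; apply: coprimep_expr.
by apply: coprimep_irr => //; apply: contraNneq ij => /f_inj ->.
Qed.

Lemma dvdp_family (e : I -> nat) p :
  (\prod_i f i ^+ e i %| p) = [forall i, f i ^+ e i %| p].
Proof.
rewrite dvdp_bigprod ?index_enum_uniq //.
  by apply/allP/forallP => [H i|H i _] //; apply: H; rewrite mem_index_enum.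
by move=> i j _ _; apply: coprimep_family.
Qed.

(** The multiplicity of [f i] in [D], capped at [P]; for divisors of [M] the cap loses nothing. *)
Definition mult_ord (D : {poly K}) (i : I) : 'I_P.+1 :=
  [arg max_(j > (ord0 : 'I_P.+1) | f i ^+ j %| D) (j : nat)].

Lemma dvdp_mult D i (j : 'I_P.+1) : (f i ^+ j %| D) = (j <= mult_ord D i)%N.
Proof.
rewrite /mult_ord; case: arg_maxnP => [|k kD kmax]; first by rewrite expr0 dvd1p.
apply/idP/idP => [/kmax//|jk]; apply: dvdp_trans kD.
by rewrite dvdp_exp2l.
Qed.

(** The product [E] divides [D]. If the quotient were not constant, it would have an irreducible
    factor; this factor is some [f i], and one more power of it would divide [D]. *)
Lemma dvd_family_eq D : D \is monic -> D %| M -> D = \prod_i f i ^+ mult_ord D i.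
Proof.
move=> mD dD; set E := \prod_i _.
have mE : E \is monic by apply: monic_prod => i _; apply: monic_exp.
have dE : E %| D by rewrite dvdp_family; apply/forallP => i; rewrite dvdp_mult.
apply/eqP; rewrite -eqp_monic //; rewrite eqp_sym -dvdp_size_eqp // -(divpK dE).
have mQ : D %/ E \is monic.
  by rewrite -(monicMr _ mE) divpK.
rewrite size_monicM ?monic_neq0 //.
case: (ltnP 1 (size (D %/ E))) => [|le1]; last first.
  have /eqP -> : size (D %/ E) == 1%N.
    by rewrite eqn_leq le1 size_poly_gt0 monic_neq0.
  by rewrite add1n.
case/exists_irreducible => d dI /andP[dm dQ].
have [i di] : exists i, d = f i.
  have: ~~ coprimep d M.
    rewrite irreducible_poly_coprime // negbK (dvdp_trans _ dD) // -(divpK dE).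
    exact: dvdp_mulr.
  case: (pickP (fun i => d == f i)) => [i /eqP ->|ne]; first by exists i.
  case/negP; apply: coprimep_bigprod => i _; apply: coprimep_expr.
  by apply: coprimep_irr => //; rewrite ne.
have dd : f i ^+ (mult_ord D i).+1 %| D.
  rewrite exprS -[X in _ %| X](divpK dE) dvdp_mul -?di //.
  by rewrite /E (bigD1 i) //= -di dvdp_mulr.
(* Below the cap, maximality of [mult_ord] is violated. At the cap, [f i ^+ P.+1] divides [M], so
   [f i] would divide the product of the other powers, to which it is coprime. *)
have [lt|ge] := ltnP (mult_ord D i).+1 P.+1.
  by have := dvdp_mult D i (Ordinal lt); rewrite dd /= ltnn.
have {}ge : P.+1 = (mult_ord D i).+1 by apply/eqP; rewrite eqn_leq ge ltn_ord.
have := dvdp_trans dd dD; rewrite -ge exprS (bigD1 i) //= mulrC.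
rewrite dvdp_mul2l ?expf_neq0 ?monic_neq0 // => fi.
have: coprimep (f i) (f i).
  apply: coprimep_dvdl fi _; apply: coprimep_bigprod => j ji.
  by have := @coprimep_family i j 1 P; rewrite expr1 eq_sym; apply.
by rewrite coprimepp => /eqP e; have := (f_irr i).1; rewrite e.
Qed.
End Family.

(** * Descent of the gcd and the generating function of its degree *)

(* The monic gcd is fixed by Frobenius, since g (a^q) is X * g a modulo X^n - 1. *)
Lemma gcd_descend (F : finFieldType) (L : fieldExtType F) (a : L) :
  exists2 D : {poly F}, D \is monic &
    map_poly (in_alg L) D %= gcdp ('X^(\dim {:L}) - 1) (g_poly #|F| (\dim {:L}) a).
Proof.
set n := \dim _; set g := @g_poly L #|F| n.
have X0 : 'X^n - 1 != 0 :> {poly L} by rewrite -size_poly_eq0 size_XnsubC ?dim_gt0.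
have G00 b : gcdp ('X^n - 1) (g b) != 0 by rewrite gcdp_eq0 negb_and X0.
pose G := (lead_coef (gcdp ('X^n - 1) (g a)))^-1 *: gcdp ('X^n - 1) (g a).
have GE : G %= gcdp ('X^n - 1) (g a).
  by rewrite eqp_scale ?invr_eq0 ?lead_coef_eq0.
have mG : G \is monic by rewrite monicE lead_coefZ mulVf ?lead_coef_eq0.
have [f fE] := exists_frobenius L 1.
have fg : map_poly f (g a) = g (f a).
  rewrite /g /g_poly rmorph_sum; apply: eq_bigr => i _ /=.
  by rewrite map_polyZ /= map_polyXn rmorphXn.
have fG : map_poly f G = G.
  apply/eqP; rewrite -eqp_monic ?monic_map //.
  have /eqp_trans -> // : map_poly f G %= map_poly f (gcdp ('X^n - 1) (g a)).
    by rewrite eqp_map.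
  rewrite gcdp_map fg rmorphB rmorph1 /= map_polyXn eqp_sym (eqp_trans GE) //.
  rewrite fE expn1.
  (* ['X] is coprime to ['X^n - 1], so the factor ['X] does not change the gcd. *)
  apply: (@eqp_trans _ (gcdp ('X^n - 1) ('X * g a))).
    rewrite eqp_sym; apply: Gauss_gcdpr.
    rewrite coprimep_sym -['X]subr0 -polyC0 coprimep_sym coprimep_XsubC /root.
    by rewrite !hornerE oppr0 expr0n eqn0Ngt dim_gt0 sub0r oppr_eq0 oner_eq0.
  rewrite /g /n mulX_g [g_poly _ _ _ + _]addrC -mul_polyC.
  exact: gcdp_addl_mul.
(* Elements of [L] fixed by the [q]-power map form the copy of [F] in [L]. *)
have /polyOver1P[D DE] : G \is a polyOver 1%AS.
  apply/polyOverP => i; rewrite (Fermat's_little_theorem 1%AS) dimv1.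
  by rewrite -fE -coef_map fG.
exists D; last by rewrite -[map_poly _ _]DE.
by rewrite -(map_monic (in_alg L)) -[map_poly _ _]DE.
Qed.

(* 'X^(r * e) is the sum of the [tail_coef r j] over j <= e, so that only the conditions
   "at least j" have to be counted. *)
Definition tail_coef (r j : nat) : {poly rat} :=
  if j is i.+1 then 'X^(r * j) - 'X^(r * i) else 1.

Definition local_factor (q P r : nat) : {poly rat} :=
  \sum_(j < P.+1) tail_coef r j *+ (q ^ (r * (P - j))).

Lemma sum_tail_coef r P (e : 'I_P.+1) :
  \sum_(j < P.+1) tail_coef r j *+ (j <= e)%N = 'X^(r * e).
Proof.
under eq_bigr => j _ do rewrite mulrb -ltnS.
rewrite -big_mkcond -(big_ord_widen _ (tail_coef r)) ?ltn_ord //.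
elim: (nat_of_ord e) => [|k IH]; first by rewrite big_ord1 muln0 expr0.
by rewrite big_ord_recr /= IH addrC subrK.
Qed.

Section GeneratingFunction.
Variables (F : finFieldType) (L : fieldExtType F) (I : finType) (f : I -> {poly F}) (P : nat).
Hypothesis f_irr : forall i, irreducible_poly (f i).
Hypothesis f_monic : forall i, f i \is monic.
Hypothesis f_inj : injective f.
Hypothesis prod_f : \prod_i f i ^+ P = 'X^(\dim {:L}) - 1.
Local Notation n := (\dim {:L}).
Local Notation g := (@g_poly L #|F| n).
Local Notation toL := (map_poly (in_alg L)).

Lemma sum_deg_family (e : I -> nat) :
  ((size (\prod_i f i ^+ e i)%R).-1 = \sum_i (size (f i)).-1 * e i)%N.
Proof.
rewrite size_bigprod_monic; last by move=> i; apply: monic_exp.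
by apply: eq_bigr => i _; rewrite size_exp.
Qed.

Lemma dim_family : n = (\sum_i (size (f i)).-1 * P)%N.
Proof. by rewrite -sum_deg_family prod_f size_XnsubC ?dim_gt0. Qed.

(** Let [D] be the descended gcd. Then [toL (f i ^+ j)] divides [g a] exactly when [j] is at most
    the multiplicity of [f i] in [D], so each inner sum telescopes to one power of ['X]. *)
Lemma Xn_size_gcd (a : L) :
  'X^((size (gcdp ('X^n - 1) (g a))).-1) =
  \prod_i \sum_(j < P.+1) tail_coef (size (f i)).-1 j *+ (toL (f i ^+ j) %| g a)%R.
Proof.
have [D mD DE] := gcd_descend a.
have dD : D %| \prod_i f i ^+ P.
  rewrite prod_f -(dvdp_map (in_alg L)) (eqp_dvdl _ DE) rmorphB rmorph1 /= map_polyXn.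
  exact: dvdp_gcdl.
have dvdE i (j : 'I_P.+1) : (toL (f i ^+ j) %| g a) = (j <= mult_ord f P D i)%N.
  rewrite -dvdp_mult -(dvdp_map (in_alg L)) (eqp_dvdr _ DE) dvdp_gcd andb_idl //.
  move=> _; have -> : 'X^n - 1 = toL ('X^n - 1) by rewrite rmorphB rmorph1 /= map_polyXn.
  rewrite dvdp_map -prod_f (bigD1 i) //= dvdp_mulr // dvdp_exp2l //.
  by rewrite -ltnS.
under eq_bigr => i _ do under eq_bigr => j _ do rewrite dvdE.
under eq_bigr => i _ do rewrite sum_tail_coef.
rewrite -(eqp_size DE) size_map_poly {1}(dvd_family_eq f_irr f_monic f_inj mD dD).
by rewrite sum_deg_family expr_sum.
Qed.

Lemma sum_Xn_size_gcd :
  \sum_(a : finvect_type L) 'X^((size (gcdp ('X^n - 1) (g (a : L)))).-1) =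
  \prod_i local_factor #|F| P (size (f i)).-1.
Proof.
rewrite [LHS](eq_bigr _ (fun a _ => Xn_size_gcd a)) /=.
(* Both sides expand into sums over functions [e] choosing one exponent per factor. For fixed [e],
   it remains to count the [a] for which every [f i ^+ e i] divides [g a]. *)
under [LHS]eq_bigr => a _ do rewrite bigA_distr_bigA.
rewrite exchange_big /= /local_factor bigA_distr_bigA; apply: eq_bigr => e _.
have mulrn_prod (c : I -> {poly rat}) (m : I -> nat) :
    \prod_i (c i *+ m i) = (\prod_i c i) *+ \prod_i m i.
  elim/big_ind3: _ => [|x1 x2 x3 y1 y2 y3 -> ->|//]; first by [].
  by rewrite mulrnAl mulrnAr mulrnA mulrnAC -mulrnA.
under [LHS]eq_bigr => a _ do rewrite mulrn_prod.
rewrite mulrn_prod sumrMnr; congr (_ *+ _).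
rewrite -expn_sum.
have -> : (\sum_i (size (f i)).-1 * (P - e i) = n - (size (\prod_i f i ^+ e i)%R).-1)%N.
  rewrite sum_deg_family {1}dim_family -sumnB //; last first.
    by move=> i _; rewrite leq_mul2l -ltnS ltn_ord orbT.
  by apply: eq_bigr => i _; rewrite mulnBr.
rewrite -card_dvd_g; last first.
  rewrite -prod_f dvdp_family //; apply/forallP => i.
  by rewrite (bigD1 i) //= dvdp_mulr // dvdp_exp2l // -ltnS.
(* By coprimality, the product of the indicators is the indicator of divisibility by the whole
   product. *)
rewrite -[RHS]sum1_card [RHS]big_mkcond /=; apply: eq_bigr => a _; rewrite inE.
rewrite rmorph_prod dvdp_bigprod ?index_enum_uniq //; last first.
  by move=> i j _ _ ij; rewrite coprimep_map coprimep_family.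
case: allP => [H|/allP/allPn[i _ /negPf H]].
  by rewrite big1 // => i _; rewrite H ?mem_index_enum.
by rewrite (bigD1 i) //= H.
Qed.

Lemma num_k_normalE k :
  (num_k_normal L k)%:R = (\prod_i local_factor #|F| P (size (f i)).-1)`_k.
Proof.
rewrite -sum_Xn_size_gcd coef_sum /num_k_normal -sum1_card natr_sum big_mkcond /=.
apply: eq_bigr => a _; rewrite inE coefXn /k_normal.
(* The gcd is nonzero, so [.-1] on its size gives a true degree. *)
have : (0 < size (gcdp ('X^n - 1) (g (a : L))))%N.
  by rewrite size_poly_gt0 gcdp_eq0 negb_and -size_poly_eq0 size_XnsubC ?dim_gt0.
by case: (size _) => // m _ /=; rewrite eqSS eq_sym; case: eqP.
Qed.
End GeneratingFunction.

(** * Coefficients of the local factors and of their product *)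

(** For [h] irreducible of degree [r] over a field with [q] elements, this is the number of residues
    modulo [h^P] whose gcd with [h^P] is [h^j]; it is 1 at [j = P] and 0 beyond. *)
Definition local_coef (q P r j : nat) : rat :=
  if (j < P)%N then (q ^ (r * (P - j)))%:R - (q ^ (r * (P - j.+1)))%:R
  else (j == P)%:R.

(** Summation by parts: each ['X^(r * j)] with [j < P] occurs in two consecutive tail terms, with
    weights [t j] and [- t j.+1]. *)
Lemma local_factorE q P r :
  local_factor q P r = \sum_(j < P.+1) local_coef q P r j *: 'X^(r * j).
Proof.
pose t j : rat := (q ^ (r * (P - j)))%:R.
transitivity (\sum_(j < P.+1) t j *: 'X^(r * j) - \sum_(j < P) t j.+1 *: 'X^(r * j)).
  rewrite /local_factor big_ord_recl [in RHS]big_ord_recl /= -addrA muln0 expr0 -sumrB.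
  congr (_ + _); first by rewrite -scaler_nat.
  by apply: eq_bigr => i _; rewrite -scaler_nat /= scalerBr.
rewrite !big_ord_recr /= addrAC -sumrB; congr (_ + _).
  by apply: eq_bigr => i _; rewrite /local_coef ltn_ord scalerBl.
by rewrite /local_coef /t ltnn eqxx subnn muln0.
Qed.

Lemma coef_local_factor q P r k : (0 < r)%N ->
  (local_factor q P r)`_k = if (r %| k)%N then local_coef q P r (k %/ r) else 0.
Proof.
move=> r0; rewrite local_factorE coef_sum.
case: dvdnP => [[j ->]|ndv]; last first.
  rewrite big1 // => i _; rewrite coefZ coefXn.
  by case: eqP => [e|_]; [case: ndv; exists i; rewrite e mulnC | rewrite mulr0].
rewrite mulnK //; case: (ltnP j P.+1) => jP.
  rewrite (bigD1 (Ordinal jP)) //= big1 ?addr0.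
    by rewrite coefZ coefXn mulnC eqxx mulr1.
  move=> i; rewrite -val_eqE /= => ne; rewrite coefZ coefXn mulnC eqn_pmul2l //.
  by rewrite eq_sym (negPf ne) mulr0.
rewrite big1 => [|i _].
  by rewrite /local_coef ltnNge (ltnW jP) gtn_eqF.
by rewrite coefZ coefXn mulnC eqn_pmul2l // gtn_eqF ?mulr0 // (leq_trans (ltn_ord i)).
Qed.

(** Modulo ['X^4] and up to [w r], the factor is [1 + a X + b X^2 + c X^3], [1 + a2 X^2] or
    [1 + a3 X^3] for [r] equal to 1, 2 or 3, and 1 for larger [r]. The lower coefficients are
    carried along for the induction. *)
Lemma coef_prod_le3 (u : nat -> {poly rat}) (w : nat -> rat) (a b c a2 a3 : rat) (rs : seq nat) :
  (forall r, (0 < r)%N ->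
   [/\ (u r)`_0 = w r, (u r)`_1 = w r * (a *+ (r == 1)%N),
       (u r)`_2 = w r * (b *+ (r == 1)%N + a2 *+ (r == 2)%N)
     & (u r)`_3 = w r * (c *+ (r == 1)%N + a3 *+ (r == 3)%N)]) ->
  all (fun r => 0 < r)%N rs ->
  let v k : rat := (count_mem k rs)%:R in
  let C := \prod_(r <- rs) w r in let U := \prod_(r <- rs) u r in
  [/\ U`_0 = C, U`_1 = C * (v 1%N * a),
      U`_2 = C * (v 1%N * b + v 1%N * (v 1%N - 1) / 2 * a ^+ 2 + v 2%N * a2)
    & U`_3 = C * (v 1%N * c + v 1%N * (v 1%N - 1) * a * b
        + v 1%N * (v 1%N - 1) * (v 1%N - 2) / 6 * a ^+ 3 + v 1%N * v 2%N * a * a2 + v 3%N * a3)].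
Proof.
move=> uE; elim: rs => [_ /=|r rs IH /= /andP[r0 /IH[]]].
  rewrite !big_nil !coef1 /= !mul0r !add0r !mulr0; split=> //; ring.
rewrite !big_cons; set U := \prod_(_ <- _) u _; set C := \prod_(_ <- _) w _.
move=> U0 U1 U2 U3; have [u0 u1 u2 u3] := uE r r0.
rewrite !coefM !big_ord_recl !big_ord0 /= /bump /= U0 U1 U2 U3 u0 u1 u2 u3 !natrD.
set v1 : rat := (count_mem 1%N rs)%:R.
move: r0; set v2 : rat := (count_mem 2%N rs)%:R; set v3 : rat := (count_mem 3%N rs)%:R.
(* The counts become arbitrary rationals, leaving a field identity for each of [r = 1, 2, 3] and
   [r > 3]. *)
clearbody v1 v2 v3 C; clear.
by case: r => [//|[|[|[|r]]]] _ /=; split; field.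
Qed.

Section LocalCoef.
Variables (q P : nat).
Hypotheses (q_gt1 : (1 < q)%N) (P_gt0 : (0 < P)%N).
Local Notation Q := (q%:R : rat).

Lemma local_coef_lt r j : (j < P)%N ->
  local_coef q P r j = Q ^+ (r * (P - j.+1)) * (Q ^+ r - 1).
Proof.
move=> jP; rewrite /local_coef jP mulrBr mulr1 -exprD -mulnSr subnSK //.
by rewrite !natrX.
Qed.

Lemma Qr_neq1 r : (0 < r)%N -> Q ^+ r - 1 != 0.
Proof.
by move=> r0; rewrite subr_eq0 -natrX pnatr_eq1 gtn_eqF // (leq_ltn_trans r0) // ltn_expl.
Qed.

Lemma Q_neq0 : Q != 0.
Proof. by rewrite pnatr_eq0 -lt0n ltnW. Qed.

(** Dividing by the constant coefficient leaves [Q ^- (r * j)] for [j < P]. Only [j = P] and [j > P]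
    behave differently, which is the source of the case split on [p ^ s]. *)
Definition coef_ratio r j := local_coef q P r j / local_coef q P r 0.

Lemma coef_ratio_lt r j : (0 < r)%N -> (j < P)%N -> coef_ratio r j = Q ^- (r * j).
Proof.
move=> r0 jP; rewrite /coef_ratio !local_coef_lt //.
rewrite invfM mulrACA divff ?Qr_neq1 // mulr1.
rewrite (_ : r * (P - 1) = r * (P - j.+1) + r * j)%N; last first.
  by rewrite -mulnDr -[in LHS](subnK jP) addnS subn1.
by rewrite exprD invfM mulrA divff ?mul1r ?expf_neq0 ?Q_neq0.
Qed.

Lemma coef_ratio_eq r : coef_ratio r P = (Q ^+ (r * P.-1) * (Q ^+ r - 1))^-1.
Proof.
by rewrite /coef_ratio [in X in _ / X]local_coef_lt // /local_coef ltnn eqxx mul1r subn1.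
Qed.

Lemma coef_ratio_gt r j : (P < j)%N -> coef_ratio r j = 0.
Proof. by move=> Pj; rewrite /coef_ratio /local_coef ltnNge ltnW //= gtn_eqF ?mul0r. Qed.

Lemma coef3_prod_local_factor (rs : seq nat) : all (fun r => 0 < r)%N rs ->
  let v k : rat := (count_mem k rs)%:R in
  let R := coef_ratio in
  (\prod_(r <- rs) local_factor q P r)`_3 =
  Q ^+ (sumn rs * P.-1) * \prod_(r <- rs) (Q ^+ r - 1) *
  (v 1%N * R 1%N 3%N + v 1%N * (v 1%N - 1) * R 1%N 1%N * R 1%N 2%N
    + v 1%N * (v 1%N - 1) * (v 1%N - 2) / 6 * R 1%N 1%N ^+ 3
    + v 1%N * v 2%N * R 1%N 1%N * R 2%N 1%N + v 3%N * R 3%N 1%N).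
Proof.
move=> rs0 v R.
have w0 r : (0 < r)%N -> local_coef q P r 0 != 0.
  by move=> r0; rewrite local_coef_lt // mulf_neq0 ?expf_neq0 ?Q_neq0 ?Qr_neq1.
have RE r j : (0 < r)%N -> local_coef q P r j = local_coef q P r 0 * R r j.
  by move=> r0; rewrite mulrC divfK ?w0.
have := @coef_prod_le3 (local_factor q P) (local_coef q P ^~ 0%N)
  (R 1 1)%N (R 1 2)%N (R 1 3)%N (R 2 1)%N (R 3 1)%N rs _ rs0.
case=> [r r0|_ _ _ ->]; last first.
  congr (_ * _); elim: rs rs0 {v} => [|r rs IH] /=; first by rewrite !big_nil mulr1.
  case/andP=> r0 /IH e; rewrite !big_cons e local_coef_lt // mulnDl exprD subn1.
  by rewrite mulrACA.
rewrite !coef_local_factor // dvdn0 div0n.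
split=> //; case: r r0 => [|[|[|[|r]]]] //= _;
  rewrite ?mulr0n ?addr0 ?add0r ?mulr0 -?RE //.
Qed.
End LocalCoef.

(** * Factorization of ['X^n - 1] over [F] *)

(** A root [z] of [h] generates an extension [E] of degree [deg h]. Since [z ^+ m = 1], the [q ^ d]
    power map fixes [z], hence all of [E], so the order [deg h] of the Frobenius generator divides
    [d]. *)
Lemma degree_dvd_order (F : finFieldType) (h : {poly F}) (m d : nat) :
  irreducible_poly h -> h %| 'X^m - 1 -> (0 < d)%N -> #|F| ^ d = 1 %[mod m] -> ((size h).-1 %| d)%N.
Proof.
move=> hI hm d0 qd.
have [E dimE [z hz genz]] := irredp_FAdjoin hI.
pose E' := FinSplittingFieldType F E.
have zm : z ^+ m = 1.
  have := dvdp_trans (dvdpp _) hm; rewrite -(dvdp_map (in_alg E)) => /dvdpP[k ek].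
  have := congr1 (fun p => p.[z]) ek; rewrite /= hornerM (rootP hz) mulr0.
  by rewrite rmorphB rmorph1 /= map_polyXn !hornerE => /eqP; rewrite subr_eq0 => /eqP.
have zq : z ^+ (#|F| ^ d) = z.
  have q0 : (0 < #|F| ^ d)%N by rewrite expn_gt0 (ltnW (finNzRing_gt1 F)).
  move/eqP: qd; rewrite eqn_mod_dvd // => /dvdnP[k e].
  by rewrite -(subnK q0) e exprD expr1 mulnC exprM zm expr1n mul1r.
have [f fE] := exists_frobenius E d.
have fid y : f y = y.
  have /Fadjoin_polyP[p /polyOver1P[p' ->] ->] : y \in <<1; z>>%VS by rewrite genz memvf.
  rewrite -horner_map /= [f z]fE zq -map_poly_comp; congr (_.[_]).
  apply: eq_map_poly => c /=; rewrite fE exprZn expf_card_exp expr1n //.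
have [alpha gen_alpha alphaE] := finField_galois_generator (subvf (1%AS : {subfield E'})).
have : #[alpha]%g = (size h).-1.
  rewrite orderE -(eqP gen_alpha) -(galois_dim (finField_galois (subvf _))).
  by rewrite dimv1 divn1.
move=> <-; rewrite order_dvdn; apply/gal_eqP => y _; rewrite gal_id -[RHS]fid fE.
elim: d {d0 qd zq fE} y => [|d IH] y; first by rewrite expg0 gal_id expr1.
rewrite expgS galM ?memvf // IH alphaE ?memvf // dimv1 expn1.
by rewrite -exprM expnS.
Qed.

Section Factorization.
Variables (F : finFieldType) (p n s n0 : nat).
Hypotheses (pcharFp : p \in [pchar F]) (n_gt0 : (0 < n)%N).
Hypotheses (nE : n = (p ^ s * n0)%N) (n0p : coprime n0 p).

Definition is_factor (h : {poly F}) :=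
  [&& h \is monic, irreducibleb h & h %| 'X^n - 1].

(** The bound [n.+1] on sizes makes the index type finite and excludes no divisor of ['X^n - 1]. *)
Definition factor_idx := {h : {poly_n.+1 F} | is_factor h}.
Definition factor (i : factor_idx) : {poly F} := val (val i).

Lemma factorP i : [/\ factor i \is monic, irreducible_poly (factor i) & factor i %| 'X^n - 1].
Proof. by case/and3P: (valP i) => ? /irreducibleP ? ?. Qed.

Lemma factor_inj : injective factor.
Proof. by move=> i j /val_inj/val_inj. Qed.

Lemma factorE h : is_factor h -> {i | factor i = h}.
Proof.
move=> hf; have sz : (size h <= n.+1)%N.
  case/and3P: hf => _ _ /dvdp_leq; rewrite size_XnsubC //; apply.
  by rewrite -size_poly_eq0 size_XnsubC.
have hf' : is_factor (NPoly sz) by [].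
by exists (Sub (NPoly sz) hf').
Qed.

Lemma n0_gt0 : (0 < n0)%N.
Proof. by move: n_gt0; rewrite nE muln_gt0 => /andP[]. Qed.

Lemma Xn_sub1_pchar : 'X^n - 1 = ('X^n0 - 1) ^+ (p ^ s) :> {poly F}.
Proof.
have pP : ([pchar {poly F}]).-nat (p ^ s)%N.
  rewrite pnatX; apply/orP; left; rewrite pnatE ?pchar_poly //.
  exact: pcharf_prime pcharFp.
by rewrite exprDn_pchar // exprNn_pchar // expr1n -exprM mulnC -nE.
Qed.

Lemma irr_dvd_Xn0_sub1 (h : {poly F}) :
  irreducible_poly h -> h %| 'X^n - 1 -> h %| 'X^n0 - 1.
Proof.
move=> hI; apply: contraTT; rewrite -!irreducible_poly_coprime // Xn_sub1_pchar.
exact: coprimep_expr.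
Qed.

(** As [n0] is prime to the characteristic, ['X^n0 - 1] is separable. An irreducible factor [h] of
    its quotient by [E] would also divide [E], and separability would make [h] coprime to itself. *)
Lemma prod_factor : \prod_i factor i ^+ (p ^ s) = 'X^n - 1.
Proof.
rewrite Xn_sub1_pchar prodrXl; congr (_ ^+ _).
have mX : 'X^n0 - 1 \is @monic F by rewrite monicXnsubC ?n0_gt0.
have sepX : separable_poly ('X^n0 - 1 : {poly F}).
  rewrite separable_Xn_sub_1 // -(dvdn_pcharf pcharFp).
  rewrite -prime_coprime ?(pcharf_prime pcharFp) //.
  by rewrite coprime_sym.
set E := \prod_i _.
have mE : E \is monic by apply: monic_prod => i _; case: (factorP i).
have dE : E %| 'X^n0 - 1.
  rewrite /E; under eq_bigr => i _ do rewrite -[factor i]expr1.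
  rewrite dvdp_family; last exact: factor_inj.
  - by apply/forallP => i; rewrite expr1; case: (factorP i) => ? ? ?; apply: irr_dvd_Xn0_sub1.
  - by move=> i; case: (factorP i).
  - by move=> i; case: (factorP i).
have mQ : ('X^n0 - 1) %/ E \is monic by rewrite -(monicMr _ mE) divpK.
rewrite -[RHS](divpK dE).
have [/exists_irreducible[h hI /andP[hm hQ]]|le1] := ltnP 1 (size (('X^n0 - 1) %/ E)).
  have hX : h %| 'X^n - 1.
    rewrite Xn_sub1_pchar (dvdp_trans hQ) // (dvdp_trans (divp_dvd dE)) //.
    by rewrite -{1}['X^n0 - 1]expr1 dvdp_exp2l // expn_gt0 prime_gt0 ?(pcharf_prime pcharFp).
  have [|i hi] := @factorE h; first by rewrite /is_factor hm hX andbT; apply/irreducibleP.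
  have hE : h %| E by rewrite /E (bigD1 i) //= -hi dvdp_mulr.
  have : coprimep h h.
    by apply: (separable_coprime sepX); rewrite -[X in _ %| X](divpK dE) dvdp_mul.
  by rewrite coprimepp => /eqP e; have := hI.1; rewrite e.
have /size_poly1P[c c0 cE] : size (('X^n0 - 1) %/ E) == 1%N.
  by rewrite eqn_leq le1 size_poly_gt0 monic_neq0.
by move: mQ; rewrite cE monicE lead_coefC => /eqP ->; rewrite mul1r.
Qed.

(** The two counts live in different finite types, so both are compared as duplicate-free lists in
    [{poly F}]. *)
Lemma num_irr_factorsE r :
  num_irr_factors F n r = count_mem r [seq (size (factor i)).-1 | i : factor_idx].
Proof.
rewrite count_map /num_irr_factors cardE -(size_map val).
rewrite -size_filter -(size_map factor); apply: perm_size; apply: uniq_perm.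
- by rewrite map_inj_uniq ?enum_uniq //; apply: val_inj.
- by rewrite (map_inj_uniq factor_inj) filter_uniq ?enum_uniq.
move=> h; apply/mapP/mapP => [[x] | [i]].
  rewrite mem_enum inE => /and4P[/eqP sz hm hI hd] ->.
  have [|i hi] := @factorE x; first by rewrite /is_factor hm hI.
  by exists i; rewrite ?hi // mem_filter /= hi sz /= eqxx mem_enum.
rewrite mem_filter /= => /andP[/eqP sz _] ->.
have [hm hI hd] := factorP i.
have szi : size (factor i) = r.+1 by rewrite -sz prednK // ltnW // hI.1.
have szi' : (size (factor i) <= r.+1)%N by rewrite szi.
by exists (NPoly szi') => //; rewrite mem_enum inE /= szi eqxx hm hd andbT; apply/irreducibleP.
Qed.
End Factorization.

(** * The count of 3-normal elements *)

Lemma prod_divisors_count (d : nat) (rs : seq nat) (w : nat -> rat) : (0 < d)%N ->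
  all (fun r => r %| d)%N rs ->
  \prod_(r <- divisors d) w r ^+ count_mem r rs = \prod_(r <- rs) w r.
Proof.
move=> d0; elim: rs => [_|r rs IH /= /andP[rd /IH e]].
  by rewrite big_nil big1.
rewrite big_cons -e; under eq_bigr => i _ do rewrite exprD.
rewrite big_split /=; congr (_ * _).
have rdiv : r \in divisors d by rewrite -dvdn_divisors.
rewrite (bigD1_seq r) ?divisors_uniq //= eqxx expr1 big1 ?mulr1 // => i ir.
by rewrite eq_sym (negPf ir).
Qed.

(** The common formula behind all four cases, which differ only in the values of [R]. *)
Lemma num_3_normalE (F : finFieldType) (L : fieldExtType F)
  (q p n s n0 d : nat)
  (hq : #|F| = q)
  (hp : p \in [pchar F])
  (hn : \dim {:L} = n)
  (hn_gt0 : (0 < n)%N)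
  (hns : n = (p ^ s * n0)%N)
  (hn0 : coprime n0 p)
  (hd_gt0 : (0 < d)%N)
  (hd_order : q ^ d = 1 %[mod n0]) :
  let v (r : nat) : rat := (num_irr_factors F n r)%:R in
  let Q : rat := q%:R in
  let R := coef_ratio q (p ^ s) in
  (num_k_normal L 3)%:R =
  Q ^+ (n - n0) * \prod_(r <- divisors d) (Q ^+ r - 1) ^+ num_irr_factors F n r *
  (v 1%N * R 1%N 3%N + v 1%N * (v 1%N - 1) * R 1%N 1%N * R 1%N 2%N
    + v 1%N * (v 1%N - 1) * (v 1%N - 2) / 6 * R 1%N 1%N ^+ 3
    + v 1%N * v 2%N * R 1%N 1%N * R 2%N 1%N + v 3%N * R 3%N 1%N).
Proof.
move=> v Q R; case: n / hn hn_gt0 hns @v => n_gt0 nE v.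
set n' := \dim _ in v n_gt0 nE *.
have p_pr := pcharf_prime hp.
have P_gt0 : (0 < p ^ s)%N by rewrite expn_gt0 prime_gt0.
have q_gt1 : (1 < q)%N by rewrite -hq finNzRing_gt1.
have fm (i : factor_idx F n') : factor i \is monic by case: (factorP i).
have fI (i : factor_idx F n') : irreducible_poly (factor i) by case: (factorP i).
have prodf := prod_factor hp n_gt0 nE hn0.
pose rs := [seq (size (factor i)).-1 | i : factor_idx F n'].
have rs0 : all (fun r => 0 < r)%N rs.
  by apply/allP => _ /imageP[i _ ->]; have := (fI i).1; case: (size _) => [|[]].
(* Comparing degrees in the factorization gives [sumn rs * p ^ s = n]. *)
have n0E : sumn rs = n0.
  apply/eqP; rewrite -(eqn_pmul2r P_gt0) [X in _ == X]mulnC -nE /n' (dim_family fm prodf).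
  by rewrite -big_distrl sumnE big_image.
have rsd : all (fun r => r %| d)%N rs.
  apply/allP => _ /imageP[i _ ->]; have [_ _ hX] := factorP i.
  apply: (@degree_dvd_order F (factor i) n0) => //; last by rewrite hq.
  exact: (irr_dvd_Xn0_sub1 hp nE).
have vE r : num_irr_factors F n' r = count_mem r rs := num_irr_factorsE F n_gt0 r.
rewrite (num_k_normalE fI fm (@factor_inj F n') prodf) hq.
have -> : \prod_(i : factor_idx F n') local_factor q (p ^ s) (size (factor i)).-1 =
    \prod_(r <- rs) local_factor q (p ^ s) r by rewrite big_image.
rewrite (coef3_prod_local_factor q_gt1 P_gt0 rs0) /v !vE.
congr (_ ^+ _ * _ * _).
  by rewrite nE -subn1 mulnBr muln1 n0E mulnC.
under [RHS]eq_bigr => r _ do rewrite vE.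
by rewrite prod_divisors_count.
Qed.

Theorem proposition4p3 (F : finFieldType) (L : fieldExtType F)
  (q p n s n0 d : nat)
  (hq : #|F| = q)
  (hp : p \in [pchar F])
  (hn : \dim {:L} = n)
  (hn_gt0 : (0 < n)%N)
  (hns : n = (p ^ s * n0)%N)
  (hn0 : coprime n0 p)
  (hd_gt0 : (0 < d)%N)
  (hd_order : q ^ d = 1 %[mod n0])
  (hd_least : forall e : nat, (0 < e)%N -> q ^ e = 1 %[mod n0] -> (d <= e)%N) :
  let v (r : nat) : nat := num_irr_factors F n r in
  let v1 : rat := (v 1%N)%:R in
  let v2 : rat := (v 2%N)%:R in
  let v3 : rat := (v 3%N)%:R in
  let Q : rat := q%:R in
  let N3 : rat := (num_k_normal L 3)%:R in
  let prodv : rat :=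
    \prod_(r <- divisors d) (Q ^+ r - 1) ^+ v r in
  let Qpow : rat := Q ^ (n%:Z - n0%:Z - 3) in
  [/\ (3 < p ^ s)%N ->
        N3 = (v1 + 6^-1 * v1 * (v1 - 1) * (v1 + 4) + v1 * v2 + v3)
             * Qpow * prodv,
      (p ^ s)%N = 3%N ->
        N3 = (Q / (Q - 1) * v1 + 6^-1 * v1 * (v1 - 1) * (v1 + 4)
              + v1 * v2 + v3)
             * Qpow * prodv,
      (p ^ s)%N = 2%N ->
        N3 = ((Q / (Q - 1) + (v1 - 2) / 6) * v1 * (v1 - 1)
              + v1 * v2 + v3)
             * Qpow * prodv
    & n = n0 ->
        N3 = (v1 * (v1 - 1) * (v1 - 2) / (6 * (Q - 1) ^+ 3)
              + v1 * v2 / ((Q - 1) * (Q ^+ 2 - 1)) + v3 / (Q ^+ 3 - 1))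
             * prodv].
move=> v v1 v2 v3 Q N3 prodv Qpow.
have q_gt1 : (1 < q)%N by rewrite -hq finNzRing_gt1.
have N3E := num_3_normalE hq hp hn hn_gt0 hns hn0 hd_gt0 hd_order.
rewrite -/N3 -/Q -/prodv /= -/v -/v1 -/v2 -/v3 -[X in _ * X * _]/prodv in N3E.
have P_gt0 : (0 < p ^ s)%N by rewrite expn_gt0 prime_gt0 ?(pcharf_prime hp).
have Q0 : Q != 0 := Q_neq0 q_gt1.
have Q1 : Q - 1 != 0 by have := @Qr_neq1 q q_gt1 1; rewrite expr1; apply.
have Q2 : Q ^+ 2 - 1 != 0 by apply: Qr_neq1.
have Q3 : Q ^+ 3 - 1 != 0 by apply: Qr_neq1.
have n0n : (n0 <= n)%N by rewrite hns leq_pmull.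
(* The integer exponent may be negative, so it is split into a natural power and a division. *)
have QpowE : Qpow = Q ^+ (n - n0) / Q ^+ 3.
  by rewrite /Qpow subzn // expfzDr.
rewrite {}QpowE; clearbody v1 v2 v3 N3 prodv.
set S := Q ^+ (n - n0) in N3E *; have SE : S = Q ^+ (n - n0) by []; clearbody S.
split=> P_eq.
(* Every term carries [Q ^- 3], and the two terms with [v1 * (v1 - 1)] merge into the factor
   [v1 + 4]. *)
- rewrite N3E !coef_ratio_lt ?mul1n ?muln1 //; do ?exact: ltn_trans P_eq.
  by rewrite -/Q; clearbody Q; field.
(* Only the ratio for [r = 1], [j = 3] is at the cap; it equals [Q ^- 3 * (Q / (Q - 1))]. *)
- rewrite P_eq in N3E; rewrite N3E coef_ratio_eq // !coef_ratio_lt // ?mul1n ?muln1 -/Q.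
  by clearbody Q; field; rewrite Q0 Q1.
(* Here [j = 3] exceeds the cap and contributes 0, while [j = 2] is at the cap. *)
- rewrite P_eq in N3E; rewrite N3E coef_ratio_gt // coef_ratio_eq //.
  rewrite !coef_ratio_lt // ?mul1n ?muln1 -/Q.
  by clearbody Q; field; rewrite Q0 Q1.
(* With [p ^ s = 1], the ratio at [j = 1] is [(Q ^+ r - 1)^-1] and those at [j = 2, 3] vanish. *)
- have P1 : (p ^ s)%N = 1%N.
    by apply/eqP; rewrite -(eqn_pmul2r (n0_gt0 hn_gt0 hns)) mul1n -hns P_eq.
  rewrite P1 in N3E; rewrite N3E SE P_eq subnn expr0
    [coef_ratio _ _ _ 3]coef_ratio_gt // [coef_ratio _ _ _ 2]coef_ratio_gt // !coef_ratio_eq //.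
  by rewrite !muln0 !expr0 !mul1r -/Q; clearbody Q; field; rewrite Q1 Q2 Q3.
Qed.
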